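(* Let $V$ be a finite nonempty set with $|V|=n+1$, let $T=T_V$, let $F=(V_0,\dots,V_{n-k})$ be a flag on $V$, let $\tilde\psi$ be a $k$-form on the blow-up $\tilde T$ that is smooth up to and including the boundary, and let $\psi$ be the corresponding $k$-form on $T$ (smooth on the interior of $T$, but generally discontinuous at the boundary), i.e. the form on the interior of $T$ that corresponds to $\tilde\psi$ under the diffeomorphism $\pi$ between the interiors of $\tilde T$ and $T$. Then evaluating the degree of freedom $\Psi_F(\psi)$ is equivalent to integrating $\tilde\psi$ over the face $\tilde T_F$ of $\tilde T$ corresponding to $F$: $$\Psi_F(\psi)=\int_{\tilde T_F}\tilde\psi.$$
   Context: Simplices and flags. $T_V=\{(\lambda_i)_{i\in V}\in\mathbb{R}_{\ge 0}^V : \sum_{i\in V}\lambda_i=1\}$; an orientation of $T_W$ is fixed for every nonempty $W\subseteq V$. A flag on $V$ is an ordered partition $F=(V_0,\dots,V_{n-k})$ of $V$ into nonempty sets. Put $T_j=T_{V_j}$. $R=R_F$ is the simplex with barycentric coordinates $\rho_0,\dots,\rho_{n-k}$, and $\Theta_F=\prod_jT_j=\{(\theta_i)_{i\in V}\in\mathbb{R}_{\ge0}^V:\sum_{i\in V_j}\theta_i=1\ \forall j\}$, with the product orientation. The map $\Phi:R\times\Theta_F\to T$, $\lambda_i=\rho_j\theta_i$ for $i\in V_j$, restricts to a diffeomorphism of interiors $\mathring R\times\mathring\Theta_F\to\mathring T$. Degree of freedom. For a $k$-form $\psi$ on $\mathring T$ and $\boldsymbol\rho\in\mathring R$, let $\psi_{\boldsymbol\rho}$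 be the pullback of $\psi$ to $\mathring\Theta_F$ under $\boldsymbol\theta\mapsto\Phi(\boldsymbol\rho,\boldsymbol\theta)$. Then $$\Psi_F(\psi)=\int_{\Theta_F}\lim_{\rho_1\to0}\cdots\lim_{\rho_{n-k}\to0}\psi_{\boldsymbol\rho},$$ where the limits are iterated (innermost limit $\rho_{n-k}\to0$ first, with the other $\rho_j$ nonzero until their own limit is taken; $\rho_0=1-\rho_1-\dots-\rho_{n-k}$), and taken pointwise on $\mathring\Theta_F$, before integrating. Blow-up. For a face $K\le T$ let $V_K\subseteq V$ denote its (nonempty) vertex set. The blow-up $\tilde T$ is the subset of $\prod_{K\le T}\mathbb{R}_{\ge0}^{V_K}$, with coordinates $\lambda_i^K$ ($K\le T$, $i\in V_K$), defined by the equations $\sum_{i\in V_K}\lambda_i^K=1$ for all $K$ and $\lambda_i^H=\rho_K^H\lambda_i^K$ for all $K\le H$ and $i\in V_K$, where $\rho_K^H=\sum_{i\in V_K}\lambda_i^H$. The projection $\pi:\tilde T\to T$ is $\lambda_i=\lambda_i^T$; it is a diffeomorphism between interiors. Faces of the blow-up. For a flag $F=(V_0,\dots,V_{n-k})$, the face $\tilde T_F$ of $\tilde T$ corresponding to $F$ is the subset of $\tilde T$ given by the equations $\lambda_{i'}^{E_{ii'}}=0$ for every edge $E_{ii'}$ joining vertices $i,i'$ with $i\in V_j$, $i'\in V_{j'}$ and $j<j'$. It is isomorphic to $\prod_j\tilde T_j$ ($\tilde T_j$ being the blow-up of $T_j$) via the coordinates $\lambda_i^K$, $K\le T_j$, and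 its interior is isomorphic to $\mathring\Theta_F$ via $\theta_i=\lambda_i^{T_j}$ for $i\in V_j$; it is oriented using the orientation of $\Theta_F$. *)

(* Defs.v *)
From HB Require Import structures.
From mathcomp Require Import all_boot all_order all_algebra.
From mathcomp Require Import all_classical all_reals all_analysis.

Set Implicit Arguments.
Unset Strict Implicit.
Unset Printing Implicit Defensive.

Import Order.TTheory GRing.Theory Num.Theory.
Import numFieldNormedType.Exports.

Local Open Scope classical_set_scope.
Local Open Scope ring_scope.

Section LebesgueMeasureTuple.
Context {R : realType}.
Local Open Scope ereal_scope.
(* [R] itself carries another measurable structure, not that of [lebesgue_measure]. *)
Local Notation RT := (measurableTypeR R).

Definition tuple_cons (k : nat) (p : RT * k.-tuple RT) : k.+1.-tuple RT :=
  [tuple of p.1 :: p.2].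

Fixpoint lebesgue_tuple (k : nat) : set (k.-tuple RT) -> \bar R :=
  match k with
  | 0 => dirac [tuple]
  | k'.+1 => pushforward (lebesgue_measure \x lebesgue_tuple (k := k'))
                         (@tuple_cons k')
  end.

Lemma measurable_tuple_cons k : measurable_fun setT (@tuple_cons k).
Proof. exact: (measurable_cons (f := fst) (g := snd)). Qed.

Lemma lebesgue_tuple_sigma_finite k :
  exists mu : {sigma_finite_measure set (k.-tuple RT) -> \bar R},
    lebesgue_tuple (k := k) = mu :> (set (k.-tuple RT) -> \bar R).
Proof.
elim: k => [|k [mu IH]]; first by exists (dirac [tuple]).
have mc := @measurable_tuple_cons k.
pose m : {measure set (k.+1.-tuple RT) -> \bar R} :=
  measure_function_pushforward__canonical__measure_function_Measure
    (lebesgue_measure \x mu) mc.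
have m_sf : sigma_finite setT m.
  have /sigma_finiteP[F [TF ndF Foo]] := sigma_finiteT (@lebesgue_measure R).
  have /sigma_finiteP[G [TG ndG Goo]] := sigma_finiteT mu.
  pose hd (t : k.+1.-tuple RT) : RT := tnth t ord0.
  pose tl (t : k.+1.-tuple RT) : k.-tuple RT := [tuple of behead t].
  exists (fun n => (hd @^-1` F n) `&` (tl @^-1` G n)).
    apply/esym/seteqP; split=> // t _.
    have [n1 _ Fn1] : (\bigcup_n F n) (hd t) by rewrite -TF.
    have [n2 _ Gn2] : (\bigcup_n G n) (tl t) by rewrite -TG.
    exists (maxn n1 n2) => //; split.
    - by have /subsetPset := ndF _ _ (leq_maxl n1 n2); exact.
    - by have /subsetPset := ndG _ _ (leq_maxr n1 n2); exact.
  move=> n; have [mF Fn] := Foo n; have [mG Gn] := Goo n; split.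
    apply: measurableI; rewrite -[X in measurable X]setTI.
    - exact: (@measurable_tnth _ RT k.+1 ord0).
    - exact: (@measurable_behead _ RT k).
  rewrite /m/= /pushforward (_ : _ @^-1` _ = F n `*` G n).
    by rewrite product_measure1E// lte_mul_pinfty// ge0_fin_numE.
  have tlE p : tl (tuple_cons p) = p.2 by exact: val_inj.
  by apply/seteqP; split=> p; rewrite /preimage/= tlE.
pose sfm : {sigma_finite_measure set (k.+1.-tuple RT) -> \bar R} :=
  HB.pack (m : set _ -> \bar R) (Measure.class m)
    (Measure_isSigmaFinite.Build _ _ _ (m : set _ -> \bar R) m_sf).
by exists sfm; rewrite /= IH.
Qed.

Lemma lebesgue_tuple_box k (A : 'I_k -> set RT) :
  (forall i, measurable (A i)) ->
  lebesgue_tuple (k := k) [set t | forall i, A i (tnth t i)] =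
  \prod_(i < k) lebesgue_measure (A i).
Proof.
elim: k A => [|k IH] A mA.
  rewrite big_ord0 /= diracE mem_set//= => -[].
  by case.
rewrite big_ord_recl -IH; last by move=> i; exact: mA.
have [mu muE] := lebesgue_tuple_sigma_finite k.
rewrite /= muE /pushforward.
rewrite (_ : _ @^-1` _ =
  A ord0 `*` [set t | forall i, A (lift ord0 i) (tnth t i)]); last first.
  apply/seteqP; split=> p; rewrite /preimage/=.
    move=> H; split; first exact: (H ord0).
    by move=> i; have := H (lift ord0 i); rewrite tnthS.
  move=> [H0 H] i; have [j ->|->//] := unliftP ord0 i.
  by rewrite tnthS; exact: H.
rewrite product_measure1E//.
rewrite (_ : mkset _ =
    \bigcap_(i in [set: 'I_k]) ((tnth (T:=RT))^~ i @^-1` A (lift ord0 i))).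
  apply: fin_bigcap_measurable => // i _.
  by rewrite -[X in measurable X]setTI; exact: (@measurable_tnth _ RT k i).
by apply/seteqP; split=> [t H i _|t H i]; [exact: H|exact: (H i)].
Qed.
End LebesgueMeasureTuple.

Section Forms.
Context {R : realType}.

(* The C^m condition through iterated directional derivatives. *)
Fixpoint Cm_on (W : normedModType R) (m : nat) (U : set W) (f : W -> R) : Prop :=
  (forall x, U x -> {for x, continuous f}) /\
  match m with
  | 0 => True
  | m'.+1 => forall v, (forall x, U x -> derivable f x v) /\ Cm_on m' U ('D_v f)
  end.

Definition smooth_on (W : normedModType R) (U : set W) (f : W -> R) : Prop :=
  forall m, Cm_on m U f.

Definition alternating_multilinear (k : nat) (W : lmodType R)
    (f : ('I_k -> W) -> R) : Prop :=
  (forall (v : 'I_k -> W) i a x y,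
     f (dfwith v i (a *: x + y)) = a * f (dfwith v i x) + f (dfwith v i y)) /\
  (forall (v : 'I_k -> W) i j, i != j -> v i = v j -> f v = 0).

(* A k-form on a subset of [W] is given by its values [w p v], of which only
   those with [p] in the subset and all the [v a] tangent to it are meaningful. *)
Definition kform (k : nat) (W : Type) := W -> ('I_k -> W) -> R.

Definition smooth_kform (k : nat) (W : normedModType R) (U : set W)
    (w : kform k W) : Prop :=
  (forall p, U p -> alternating_multilinear (w p)) /\
  (forall v, smooth_on U (w ^~ v)).

Definition pullback (k : nat) (W W' : normedModType R) (f : W -> W')
    (w : kform k W') : kform k W :=
  fun p v => w (f p) (fun a => 'D_(v a) f p).

(* One-sided velocities at [p] of curves in [X]; on a manifold with corners
   they form the inner tangent sector, which spans the tangent space. *)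
Definition tangent_cone (W : normedModType R) (X : set W) (p : W) : set W :=
  [set v | exists g : R -> W, (\forall t \near (0 : R)^'+, X (g t)) /\
     t^-1 *: (g t - p) @[t --> (0 : R)^'+] --> v].

Definition tangent_space (W : normedModType R) (X : set W) (p : W) : set W :=
  [set v | exists (N : nat) (c : 'I_N -> R) (w : 'I_N -> W),
     (forall a, tangent_cone X p (w a)) /\ v = \sum_a c a *: w a].

(* For a submanifold with corners [X], smoothness up to and including the
   boundary is the existence of smooth local extensions to the ambient space. *)
Definition smooth_kform_on (k : nat) (W : normedModType R) (X : set W)
    (w : kform k W) : Prop :=
  forall p, X p -> exists (U : set W) (w' : kform k W),
    [/\ open U, U p, smooth_kform U w' &
      forall q, X q -> U q -> forall v, (forall a, tangent_space X q (v a)) ->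
        w q v = w' q v].

(* [iterlim m G [::]] is lim_{x_1 -> 0+} .. lim_{x_m -> 0+} G [:: x_1; ..; x_m],
   the limit in x_m being taken first. *)
Fixpoint iterlim (m : nat) (G : seq R -> R) (r : seq R) : R :=
  match m with
  | 0 => G r
  | m'.+1 => lim (iterlim m' G (rcons r t) @[t --> (0 : R)^'+])
  end.

(* All the limits in [iterlim m G r] exist, the outer variables ranging over
   positive numbers of sum less than 1. *)
Fixpoint iterlim_exists (m : nat) (G : seq R -> R) (r : seq R) : Prop :=
  match m with
  | 0 => True
  | m'.+1 =>
      (forall t, 0 < t -> \sum_(x <- rcons r t) x < 1 ->
         iterlim_exists m' G (rcons r t)) /\
      cvg (iterlim m' G (rcons r t) @[t --> (0 : R)^'+])
  end.
End Forms.

Notation vec R I := 'rV[R]_#|{: I}|.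

Section Vec.
Context {R : realType} {I : finType}.

Definition crd (x : vec R I) (i : I) : R := x 0 (enum_rank i).

Definition mkvec (f : I -> R) : vec R I := \row_a f (enum_val a).
End Vec.

Record flag (V : finType) (m : nat) := Flag {
  block :> 'I_m.+1 -> {set V};
  block_inj : injective block;
  block_partition :
    finset.partition [set block j | j : 'I_m.+1]%SET [set: V]%SET }.

(* An ordering [w_0, .., w_d] of [W] makes [lambda_{w_1}, .., lambda_{w_d}] an
   oriented chart of [T_W], up to the sign [ori_neg]; the sign is only needed to
   allow both orientations of a point. *)
Record orientation (V : finType) (W : {set V}) := Orientation {
  ori_seq : seq V;
  ori_neg : bool;
  ori_perm : perm_eq ori_seq (enum W) }.

Section DegreeOfFreedom.
Context {R : realType} {V : finType} {m : nat} (F : flag V m).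

(* rho_0, .., rho_m from [r = [:: rho_1; ..; rho_m]] *)
Definition bary (r : seq R) (j : 'I_m.+1) : R :=
  nth 0 (1 - \sum_(x <- r) x :: r) j.

Definition Phi (rho : 'I_m.+1 -> R) (theta : vec R V) : vec R V :=
  mkvec (fun i => \sum_(j | i \in F j) rho j * crd theta i).

Definition Theta_int : set (vec R V) :=
  [set theta | (forall i, 0 < crd theta i) /\
               (forall j, \sum_(i in F j) crd theta i = 1)].

Definition Theta_tangent : set (vec R V) :=
  [set v | forall j, \sum_(i in F j) crd v i = 0].

Variable o : forall W : {set V}, orientation W.

(* The vertices indexing the product chart of [Theta_F], in order. *)
Definition chart_vertices : seq V :=
  flatten [seq behead (ori_seq (o (F j))) | j <- enum 'I_m.+1].

Definition chart_sign : R := \prod_(j < m.+1) (-1) ^+ ori_neg (o (F j)).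

(* The inverse of the chart: the coordinate of the first vertex of each block
   is determined by the others. *)
Definition chart_inv (k : nat) (u : 'rV[R]_k) : vec R V :=
  let c i := if insub (index i chart_vertices) is Some a then u 0 a else 0 in
  mkvec (fun i => if i \in chart_vertices then c i
                  else 1 - \sum_(j | i \in F j) \sum_(i' in F j) c i').

(* The boundary of [Theta_F] is negligible: forms are only given on its interior. *)
Definition integral_Theta (k : nat) (eta : kform k (vec R V)) : \bar R :=
  let param (u : k.-tuple (measurableTypeR R)) : 'rV[R]_k :=
    \row_a tnth u a in
  (\int[lebesgue_tuple (k := k)]_(u in
       [set u | Theta_int (chart_inv (param u))])
     (chart_sign *
      pullback (@chart_inv k) eta (param u) (fun a => delta_mx 0 a))%:E)%E.

Definition limit_form (k : nat) (psi : kform k (vec R V)) : kform k (vec R V) :=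
  fun theta v =>
    iterlim m (fun r => pullback (Phi (bary r)) psi theta v) [::].

Definition limit_form_exists (k : nat) (psi : kform k (vec R V)) : Prop :=
  forall theta, Theta_int theta ->
  forall v, (forall a, Theta_tangent (v a)) ->
    iterlim_exists m (fun r => pullback (Phi (bary r)) psi theta v) [::].

Definition Psi (k : nat) (psi : kform k (vec R V)) : \bar R :=
  integral_Theta (limit_form psi).
End DegreeOfFreedom.

(* The faces of [T_V] correspond to the nonempty subsets [K] of [V]. *)
Definition bidx (V : finType) := {Ki : {set V} * V | Ki.2 \in Ki.1}.

Section BlowUp.
Context {R : realType} {V : finType}.
Implicit Types (x : vec R (bidx V)) (K H : {set V}).

(* lambda_i^K *)
Definition bcrd x K (i : V) : R :=
  if insub (K, i) is Some c then crd x (c : bidx V) else 0.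

(* rho_K^H *)
Definition bratio x K H : R := \sum_(i in K) bcrd x H i.

Definition blowup : set (vec R (bidx V)) :=
  [set x | [/\ forall K i, i \in K -> 0 <= bcrd x K i,
    forall K, K != finset.set0 -> \sum_(i in K) bcrd x K i = 1 &
    forall K H, K \subset H -> forall i, i \in K ->
      bcrd x H i = bratio x K H * bcrd x K i]].

(* The boundary of the blow-up consists of the points with a zero coordinate. *)
Definition blowup_int : set (vec R (bidx V)) :=
  [set x | blowup x /\ forall K i, i \in K -> 0 < bcrd x K i].

Definition blowdown x : vec R V := mkvec (bcrd x [set: V]%SET).

(* [psit] is the pullback of [psi] by the projection, on the interiors. *)
Definition corresponds (k : nat) (psit : kform k (vec R (bidx V)))
    (psi : kform k (vec R V)) : Prop :=
  forall x, blowup_int x ->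
  forall v, (forall a, tangent_space blowup x (v a)) ->
    pullback blowdown psi x v = psit x v.

Section Face.
Context {m : nat} (F : flag V m).

Definition blowup_face : set (vec R (bidx V)) :=
  [set x | blowup x /\ forall (j j' : 'I_m.+1) i i', (j < j')%N ->
     i \in F j -> i' \in F j' -> bcrd x [set i; i']%SET i' = 0].

(* theta_i = lambda_i^{T_j} for i in V_j *)
Definition face_chart x : vec R V :=
  mkvec (fun i => \sum_(j | i \in F j) bcrd x (F j) i).

(* The inverse of [face_chart], meaningful on the interior of [Theta_F] only,
   where the point is unique. *)
Definition face_param (theta : vec R V) : vec R (bidx V) :=
  get [set x | blowup_face x /\ face_chart x = theta].

Definition integral_face (o : forall W : {set V}, orientation W) (k : nat)
    (psit : kform k (vec R (bidx V))) : \bar R :=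
  integral_Theta F o (pullback face_param psit).
End Face.
End BlowUp.

(* Main.v *)
Require Import Defs.
From mathcomp Require Import all_boot all_order all_algebra.
From mathcomp Require Import all_classical all_reals all_analysis.
From mathcomp Require Import ring.
Import Order.TTheory GRing.Theory Num.Theory.
Import numFieldNormedType.Exports.

(** The interior of the blow-up is identified with that of [T], so [psi] at
    [Phi rho theta] is [psit] at the point of the blow-up whose coordinate
    [lambda_i^K] is the share of the vertex [i] in the total mass of [K], the
    mass of [i] being [rho_j * theta_i] for [i] in [V_j].  The point is that
    these shares, unlike [psi], keep a limit as [rho_m], then [rho_(m-1)], ..,
    then [rho_1] tend to 0.  If [K] meets a block whose [rho] is still positive,
    the denominator stays positive and the vertices of the vanishing blocks get
    share 0.  Otherwise only the first block met by [K] matters: just before its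
    [rho] goes to 0 it carries all the mass of [K], and the factor [rho] cancels.
    When all limits are taken, only the first block met by each [K] counts, and
    this point is the one of the face with coordinates [theta]
    ([face_paramE]).

    This gives an explicit point [flag_point r theta] of the blow-up for every
    list [r] of the [rho]'s not yet sent to 0.  It depends on [theta] through
    quotients of linear forms, and the same cancellation shows that its
    derivative [flag_vector r theta v] along [v] converges as well.  Since
    [flag_point r] maps a neighborhood of [theta] in [Theta_F] to the blow-up,
    its derivatives are tangent to the blow-up; there [psit] is locally the
    restriction of a form with continuous coefficients, so its values at these
    points and vectors converge ([smooth_kform_on_cvg]).  By induction on the
    number of limits ([iterlim_flag]), the iterated limit of [psi_rho] exists
    and equals the pullback of [psit] by the parametrization of the face.  The
    two integrands agree pointwise, hence so do the integrals. *)

Set Implicit Arguments.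
Unset Strict Implicit.

(** * Limits of multilinear forms *)

Section Convergence.
Local Open Scope classical_set_scope.
Local Open Scope ring_scope.
Context {R : realType}.

Lemma cvg_rV (T : Type) (F : set_system T) (FF : Filter F) n
    (f : T -> 'rV[R]_n) (l : 'rV[R]_n) :
  (forall j, f x 0 j @[x --> F] --> l 0 j) -> f @ F --> l.
Proof.
move=> fl; apply/cvg_ballP => e e0.
have : \forall x \near F, forall j, ball (l 0 j) e (f x 0 j).
  by apply: filter_forall => j; move/cvg_ballP: (fl j); apply.
apply: filterS => x lx; split=> // i j; rewrite (ord1 i); exact: lx.
Qed.

Lemma rV_cvg (T : Type) (F : set_system T) (FF : Filter F) n
    (f : T -> 'rV[R]_n) (l : 'rV[R]_n) j :
  f @ F --> l -> f x 0 j @[x --> F] --> l 0 j.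
Proof.
by move=> fl; apply: (cvg_comp _ (fun M : 'rV[R]_n => M 0 j) fl); exact: coord_continuous.
Qed.

Lemma cvg_sumr (T : Type) (F : set_system T) (FF : Filter F) (I : Type)
    (r : seq I) (P : pred I) (f : I -> T -> R) (l : I -> R) :
  (forall i, P i -> f i x @[x --> F] --> l i) ->
  \sum_(i <- r | P i) f i x @[x --> F] --> \sum_(i <- r | P i) l i.
Proof.
move=> fl; elim: r => [|i r IH].
  by rewrite big_nil; under eq_fun do rewrite big_nil; exact: cvg_cst.
rewrite big_cons; under eq_fun do rewrite big_cons.
by case: ifPn => // Pi; apply: cvgD => //; exact: fl.
Qed.

Lemma cvg_near_eq (T : Type) (U : topologicalType) (F : set_system T) (FF : Filter F)
    (f g : T -> U) (l : U) :
  (\forall x \near F, f x = g x) -> g @ F --> l -> f @ F --> l.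
Proof. by move=> fg; apply: cvg_trans; apply: near_eq_cvg; apply: filterS fg. Qed.

Lemma multilinear_sum k n (f : ('I_k -> 'rV[R]_n) -> R) v i u :
  alternating_multilinear f ->
  f (dfwith v i u) = \sum_b u 0 b * f (dfwith v i (delta_mx 0 b)).
Proof.
move=> [f_lin _].
have f0 : f (dfwith v i 0) = 0.
  have := f_lin v i 1 0 0; rewrite scaler0 addr0 mul1r => f00.
  by apply: (addrI (f (dfwith v i 0))); rewrite -f00 addr0.
rewrite {1}(row_sum_delta u).
elim/big_rec2: _ => [//|b y1 y2 _ IH].
by rewrite f_lin IH.
Qed.

(** The joint continuity of a family of multilinear forms in the parameter and
    the vectors follows from continuity in the parameter alone, because the
    vectors can be expanded on a basis, one argument at a time. *)
Lemma multilinear_cvg k n (T : Type) (F : set_system T) (FF : Filter F)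
    (w : T -> ('I_k -> 'rV[R]_n) -> R) (w0 : ('I_k -> 'rV[R]_n) -> R)
    (y : T -> 'I_k -> 'rV[R]_n) (y0 : 'I_k -> 'rV[R]_n) :
  (\forall t \near F, alternating_multilinear (w t)) ->
  alternating_multilinear w0 ->
  (forall v, w t v @[t --> F] --> w0 v) ->
  (forall a, y t a @[t --> F] --> y0 a) ->
  w t (y t) @[t --> F] --> w0 y0.
Proof.
move=> w_lin w0_lin w_cvg y_cvg.
(* The first [s] arguments vary with [t], the others are kept constant; the
   induction is on [s]. *)
pose mix s (z v : 'I_k -> 'rV[R]_n) (a : 'I_k) := if (a < s)%N then z a else v a.
suff mix_cvg s : forall v, w t (mix s (y t) v) @[t --> F] --> w0 (mix s y0 v).
  have mixk z : mix k z y0 = z by apply/funext => a; rewrite /mix ltn_ord.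
  have := mix_cvg k y0; rewrite mixk.
  by under eq_fun do rewrite mixk.
elim: s => [//|s IH v].
have [ks|sk] := leqP k s.
  have mixS z : mix s.+1 z v = mix s z v.
    by apply/funext => a; rewrite /mix !(leq_trans (ltn_ord a))// ltnW.
  by rewrite mixS; under eq_fun do rewrite mixS; exact: IH.
pose i := Ordinal sk.
have mixS z : mix s.+1 z v = dfwith (mix s z v) i (z i).
  apply/funext => a; have [->|ai] := eqVneq a i.
    by rewrite dfwithin /mix leqnn.
  rewrite dfwithout 1?eq_sym// /mix ltnS leq_eqVlt.
  by rewrite (_ : (a == s :> nat) = false)//; apply/negbTE.
have mix_dfwith z e : dfwith (mix s z v) i e = mix s z (dfwith v i e).
  apply/funext => a; have [->|ai] := eqVneq a i.
    by rewrite dfwithin /mix ltnn dfwithin.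
  by rewrite dfwithout 1?eq_sym// /mix dfwithout 1?eq_sym.
rewrite mixS multilinear_sum//.
apply: (@cvg_near_eq _ _ _ _ _
  (fun t => \sum_b y t i 0 b * w t (mix s (y t) (dfwith v i (delta_mx 0 b))))).
  apply: filterS w_lin => t wt_lin; rewrite mixS multilinear_sum//.
  by apply: eq_bigr => b _; rewrite mix_dfwith.
apply: cvg_sumr => b _; rewrite mix_dfwith; apply: cvgM; last exact: IH.
exact: rV_cvg.
Qed.

Lemma derive_cvg (W W' : normedModType R) (f : W -> W') x v l :
  h^-1 *: (f (h *: v + x) - f x) @[h --> 0^'] --> l -> 'D_v f x = l.
Proof. by move=> fl; apply: cvg_lim. Qed.

(** Affine maps have a directional derivative without any appeal to
    differentiability: the difference quotient is constant. *)
Lemma derive_line (W W' : normedModType R) (f : W -> W') x v l :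
  (forall h, f (h *: v + x) = h *: l + f x) -> 'D_v f x = l.
Proof.
move=> fl; apply: derive_cvg.
apply: (@cvg_near_eq _ _ _ _ _ (fun=> l)); last exact: cvg_cst.
near=> h; rewrite fl addrK scalerA mulVf ?scale1r//.
near: h; exact: nbhs_dnbhs_neq.
Unshelve. all: by end_near.
Qed.

(** Smoothness up to the boundary only constrains a form on tangent vectors, so
    the approaching vectors and their limit must all be tangent for the values
    to be computed by a local extension. *)
Lemma smooth_kform_on_cvg (T : Type) (F : set_system T) (FF : Filter F)
    k n (X : set 'rV[R]_n) (w : kform k 'rV[R]_n)
    (x : T -> 'rV[R]_n) (x0 : 'rV[R]_n)
    (y : T -> 'I_k -> 'rV[R]_n) (y0 : 'I_k -> 'rV[R]_n) :
  smooth_kform_on X w ->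
  (\forall t \near F, X (x t) /\ forall a, tangent_space X (x t) (y t a)) ->
  X x0 -> (forall a, tangent_space X x0 (y0 a)) ->
  x t @[t --> F] --> x0 -> (forall a, y t a @[t --> F] --> y0 a) ->
  w (x t) (y t) @[t --> F] --> w x0 y0.
Proof.
move=> w_smooth xy Xx0 y0_tan x_cvg y_cvg.
have [U [w' [Uo Ux0 [w'_lin w'_smooth] ww']]] := w_smooth _ Xx0.
have Ux : \forall t \near F, U (x t) by apply: x_cvg; exact: open_nbhs_nbhs.
rewrite (ww' _ Xx0 Ux0 _ y0_tan).
apply: (@cvg_near_eq _ _ _ _ _ (fun t => w' (x t) (y t))).
  by apply: filterS2 xy Ux => t [Xx xy_tan] Ut; exact: ww'.
apply: (@multilinear_cvg _ _ _ _ _ (fun t => w' (x t))) => //.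
- by apply: filterS Ux => t; exact: w'_lin.
- exact: w'_lin.
move=> v; have [w'_cont _] := w'_smooth v 0%N.
exact: (cvg_comp _ _ x_cvg (w'_cont _ Ux0)).
Qed.
End Convergence.

(** * Coordinates on simplices and on the blow-up *)

Section Coordinates.
Local Open Scope classical_set_scope.
Local Open Scope ring_scope.
Context {R : realType}.

Lemma crd_mkvec (I : finType) (f : I -> R) i : crd (mkvec f) i = f i.
Proof. by rewrite /crd mxE enum_rankK. Qed.

Lemma crdP (I : finType) (x y : vec R I) : crd x =1 crd y -> x = y.
Proof.
move=> xy; apply/rowP => a; have := xy (enum_val a).
by rewrite /crd enum_valK.
Qed.

Lemma crd_line (I : finType) a (x y : vec R I) i :
  crd (a *: x + y) i = a * crd x i + crd y i.
Proof. by rewrite /crd !mxE. Qed.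

Lemma crd_sub (I : finType) (x y : vec R I) i : crd (x - y) i = crd x i - crd y i.
Proof. by rewrite /crd !mxE. Qed.

Lemma crd_scale (I : finType) a (x : vec R I) i : crd (a *: x) i = a * crd x i.
Proof. by rewrite /crd !mxE. Qed.

Lemma cvg_crd (I : finType) (T : Type) (F : set_system T) (FF : Filter F)
    (f : T -> vec R I) (l : vec R I) :
  (forall i, crd (f x) i @[x --> F] --> crd l i) -> f @ F --> l.
Proof.
move=> fl; apply: cvg_rV => j; have := fl (enum_val j).
by rewrite /crd enum_valK.
Qed.

Context {V : finType}.

Lemma bcrd_mkvec (g : {set V} -> V -> R) K i :
  bcrd (mkvec (fun c : bidx V => g (val c).1 (val c).2)) K i =
  if i \in K then g K i else 0.
Proof.
rewrite /bcrd; case: insubP => [c /= -> ci|/negbTE /= -> //].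
by rewrite crd_mkvec ci.
Qed.

Lemma bcrd_in (x : vec R (bidx V)) (c : bidx V) : bcrd x (val c).1 (val c).2 = crd x c.
Proof. by rewrite /bcrd -surjective_pairing valK. Qed.

Lemma bcrdP (x y : vec R (bidx V)) :
  (forall (K : {set V}) i, i \in K -> bcrd x K i = bcrd y K i) -> x = y.
Proof. by move=> xy; apply: crdP => c; rewrite -!bcrd_in xy// (valP c). Qed.

Lemma bcrd_line a (x y : vec R (bidx V)) K i :
  bcrd (a *: x + y) K i = a * bcrd x K i + bcrd y K i.
Proof.
by rewrite /bcrd; case: insub => [c|]; rewrite ?crd_line// mulr0 addr0.
Qed.
End Coordinates.

(** * Weighted shares and their derivatives *)

Section Shares.
Local Open Scope classical_set_scope.
Local Open Scope ring_scope.
Context {R : realType} {V : finType}.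
Implicit Types (K : {set V}) (w : V -> R) (theta v : vec R V).

Definition ssum K w theta : R := \sum_(i in K) w i * crd theta i.

Definition share K w theta i : R := w i * crd theta i / ssum K w theta.

(** The derivative of [share] with respect to [theta] in the direction [v]. *)
Definition dshare K w theta v i : R :=
  (w i * crd v i * ssum K w theta - w i * crd theta i * ssum K w v)
  / ssum K w theta ^+ 2.

Lemma ssum_line K w a v theta :
  ssum K w (a *: v + theta) = a * ssum K w v + ssum K w theta.
Proof.
rewrite /ssum mulr_sumr -big_split; apply: eq_bigr => i _ /=.
by rewrite crd_line; ring.
Qed.

Lemma ssum_scale K w w' s theta : (forall i, i \in K -> w i = s * w' i) ->
  ssum K w theta = s * ssum K w' theta.
Proof.
move=> ww'; rewrite /ssum mulr_sumr; apply: eq_bigr => i iK.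
by rewrite ww'// mulrA.
Qed.

(** Homogeneity of degree 0 in the weights is what makes the shares survive when
    all the weights of a face vanish together. *)
Lemma share_scale K w w' s theta i : s != 0 -> (forall i, i \in K -> w i = s * w' i) ->
  i \in K -> share K w theta i = share K w' theta i.
Proof.
move=> s0 ww' iK; rewrite /share (ssum_scale _ ww') ww'// -[s * _ * _]mulrA.
by rewrite -mulf_div divff// mul1r.
Qed.

Lemma dshare_scale K w w' s theta v i :
  s != 0 -> (forall i, i \in K -> w i = s * w' i) ->
  i \in K -> dshare K w theta v i = dshare K w' theta v i.
Proof.
move=> s0 ww' iK; rewrite /dshare !(ssum_scale _ ww') ww'//.
set S := ssum K w' theta; set S' := ssum K w' v.
have -> : s * w' i * crd v i * (s * S) - s * w' i * crd theta i * (s * S') =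
  s ^+ 2 * (w' i * crd v i * S - w' i * crd theta i * S') by ring.
by rewrite exprMn -mulf_div divff ?mul1r// expf_neq0.
Qed.

Lemma share_cvg_line K w theta v i : ssum K w theta != 0 ->
  h^-1 * (share K w (h *: v + theta) i - share K w theta i) @[h --> (0 : R)^']
    --> dshare K w theta v i.
Proof.
move=> S0.
set S := ssum K w theta in S0 *; set S' := ssum K w v.
set N := w i * crd v i * S - w i * crd theta i * S'.
have S_cvg : h * S' + S @[h --> (0 : R)^'] --> S.
  rewrite -[X in _ --> X]add0r -[X in _ --> X + _](mul0r S').
  apply: cvgD; last exact: cvg_cst.
  apply: cvgMr_tmp; exact: nbhs_dnbhs.
apply: (@cvg_near_eq _ _ _ _ _ (fun h => N / (S * (h * S' + S)))); last first.
  rewrite /dshare -/N -/S -/S' expr2; apply: cvgM; first exact: cvg_cst.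
  by apply: cvgV; [rewrite mulf_neq0|apply: cvgM => //; exact: cvg_cst].
near=> h.
have h0 : h != 0 by near: h; exact: nbhs_dnbhs_neq.
have Sh0 : h * S' + S != 0.
  near: h; exact: (cvgr_neq0 _ S_cvg S0).
rewrite /share ssum_line crd_line -/S -/S' /N.
by field; rewrite ?S0 ?Sh0 ?h0.
Unshelve. all: by end_near.
Qed.

Lemma ssum_cvg (T : Type) (F : set_system T) (FF : Filter F) K
    (w : T -> V -> R) (w0 : V -> R) theta :
  (forall i, i \in K -> w t i @[t --> F] --> w0 i) ->
  ssum K (w t) theta @[t --> F] --> ssum K w0 theta.
Proof. by move=> w_cvg; apply: cvg_sumr => i iK; apply: cvgMr_tmp; exact: w_cvg. Qed.

Lemma share_cvg (T : Type) (F : set_system T) (FF : Filter F) K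
    (w : T -> V -> R) (w0 : V -> R) theta i :
  (forall i, i \in K -> w t i @[t --> F] --> w0 i) -> ssum K w0 theta != 0 ->
  i \in K -> share K (w t) theta i @[t --> F] --> share K w0 theta i.
Proof.
move=> w_cvg S0 iK; apply: cvgM; first by apply: cvgMr_tmp; exact: w_cvg.
by apply: cvgV => //; exact: ssum_cvg.
Qed.

Lemma dshare_cvg (T : Type) (F : set_system T) (FF : Filter F) K
    (w : T -> V -> R) (w0 : V -> R) theta v i :
  (forall i, i \in K -> w t i @[t --> F] --> w0 i) -> ssum K w0 theta != 0 ->
  i \in K -> dshare K (w t) theta v i @[t --> F] --> dshare K w0 theta v i.
Proof.
move=> w_cvg S0 iK; apply: cvgM.
  by apply: cvgB; (apply: cvgM; [apply: cvgMr_tmp; exact: w_cvg|exact: ssum_cvg]).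
apply: cvgV; first by rewrite expf_neq0.
by rewrite expr2; under eq_fun do rewrite expr2; apply: cvgM; exact: ssum_cvg.
Qed.
End Shares.

(** * Blocks of a flag *)

Section Blocks.
Local Open Scope ring_scope.
Context {V : finType} {m : nat} (F : flag V m).

Definition blk i : 'I_m.+1 := odflt ord0 [pick j | i \in F j].

Lemma mem_block i j : (i \in F j) = (j == blk i).
Proof.
have /and3P[/eqP Fcov Ftriv _] := block_partition F.
have i_blk : i \in F (blk i).
  rewrite /blk; case: pickP => [//|no_j].
  have : i \in finset.cover [set F j | j : 'I_m.+1] by rewrite Fcov inE.
  by case/finset.bigcupP => _ /imsetP[j' _ ->]; rewrite no_j.
apply/idP/eqP => [ij|-> //]; apply: (@block_inj _ _ F).
have [//|Fjj'] := eqVneq (F j) (F (blk i)).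
move/finset.trivIsetP: Ftriv => /(_ _ _ (imset_f _ _) (imset_f _ _) Fjj').
by move=> /(_ isT isT) /pred0P /(_ i); rewrite /= ij i_blk.
Qed.

Lemma block_neq0 j : exists i, i \in F j.
Proof.
have /and3P[_ _ F0] := block_partition F.
by apply/set0Pn; apply: contraNneq F0 => <-; exact: imset_f.
Qed.

Lemma sum_blocks (A : nmodType) (f : V -> A) :
  \sum_i f i = \sum_j \sum_(i in F j) f i.
Proof.
rewrite (partition_big blk xpredT)//=; apply: eq_bigr => j _.
by apply: eq_bigl => i; rewrite mem_block eq_sym.
Qed.

Lemma sum_mem_block (A : nmodType) (f : 'I_m.+1 -> A) i :
  \sum_(j | i \in F j) f j = f (blk i).
Proof. by rewrite (eq_bigl (pred1 (blk i))) ?big_pred1_eq// => j; rewrite mem_block. Qed.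
End Blocks.

(** * Points of the blow-up over the successive limits *)

Section BlowUpPoint.
Local Open Scope classical_set_scope.
Local Open Scope ring_scope.
Context {R : realType} {V : finType} {m : nat} (F : flag V m).
Implicit Types (r : seq R) (K H : {set V}) (theta v : vec R V).

(** In this section [r] lists the values of [rho_1, .., rho_l] still positive
    once [rho_m, .., rho_(l+1)] have tended to 0, so the blocks of index at most
    [size r] have a positive mass. *)
Definition low r K := [exists i' in K, (blk F i' <= size r)%N].

Definition leading K i := [forall i' in K, (blk F i <= blk F i')%N].

(** The mass of the block of [i] as seen from the face [K].  If [K] has no vertex
    of positive mass, the last coordinate to vanish on [K] is that of the first
    block met by [K], and dividing the masses by it leaves 1 on this block and 0
    on the others. *)
Definition weight r K i : R :=
  if low r K then bary r (blk F i) else (leading K i)%:R.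

Definition admissible r := (forall x, x \in r -> 0 < x) /\ \sum_(x <- r) x < 1.

Definition positive theta := forall i, 0 < crd theta i.

Lemma bary_gt0 r (j : 'I_m.+1) : admissible r -> (j <= size r)%N -> 0 < bary r j.
Proof.
move=> [r0 r1]; rewrite /bary; case: (val j) => [_|j'] /=; first by rewrite subr_gt0.
by move=> j'r; apply: r0; exact: mem_nth.
Qed.

Lemma bary_out r (j : 'I_m.+1) : (size r < j)%N -> bary r j = 0.
Proof. by move=> rj; rewrite /bary nth_default. Qed.

Lemma bary_ge0 r (j : 'I_m.+1) : admissible r -> 0 <= bary r j.
Proof.
move=> r_small; have [jr|rj] := leqP j (size r); first exact/ltW/bary_gt0.
by rewrite bary_out.
Qed.

Lemma weight_ge0 r K i : admissible r -> 0 <= weight r K i.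
Proof. by move=> r_small; rewrite /weight; case: ifP => _; [exact: bary_ge0|]. Qed.

Lemma ex_leading K i : i \in K -> exists2 i0, i0 \in K & leading K i0.
Proof.
move=> iK; case: (arg_minnP (fun i' => val (blk F i')) iK) => i0 i0K i0_min.
by exists i0 => //; apply/forall_inP.
Qed.

Lemma ssum_gt0 r K theta i : admissible r -> positive theta -> i \in K ->
  0 < ssum K (weight r K) theta.
Proof.
move=> r_small theta0 iK.
have [i0 i0K w0] : exists2 i0, i0 \in K & 0 < weight r K i0.
  rewrite /weight; have [/exists_inP[i0 i0K i0r]|_] := boolP (low r K).
    by exists i0 => //; exact: bary_gt0.
  by have [i0 i0K i0_lead] := ex_leading iK; exists i0; rewrite ?i0_lead.
rewrite /ssum (bigD1 i0)//= ltr_wpDr// ?mulr_gt0//.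
by apply: sumr_ge0 => i' _; rewrite mulr_ge0 ?weight_ge0// ltW.
Qed.

(** The compatibility equations of the blow-up come down to this: on [K], the
    weights of a larger face are a multiple of those of [K], possibly the zero
    multiple. *)
Lemma weight_sub r K H : K \subset H ->
  exists s, forall i, i \in K -> weight r H i = s * weight r K i.
Proof.
move=> KH; rewrite /weight.
have [/exists_inP[i0 i0K i0r]|/exists_inPn K_high] := boolP (low r K).
  have -> : low r H by apply/exists_inP; exists i0 => //; exact: (fintype.subsetP KH).
  by exists 1 => i _; rewrite mul1r.
have [_|_] := boolP (low r H).
  by exists 0 => i iK; rewrite mul0r bary_out// ltnNge K_high.
have [/exists_inP[i0 i0K i0H]|/exists_inPn no_lead] :=
  boolP [exists i in K, leading H i].
- exists 1 => i iK; rewrite mul1r; congr (_%:R); congr nat_of_bool.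
  apply/forall_inP/forall_inP => [iH i' i'K|iK' i' i'H].
    by apply: iH; exact: (fintype.subsetP KH).
  exact: leq_trans (iK' _ i0K) (forall_inP i0H _ i'H).
- by exists 0 => i iK; rewrite mul0r (negbTE (no_lead _ iK)).
Qed.

Definition flag_point r theta : vec R (bidx V) :=
  mkvec (fun c => share (val c).1 (weight r (val c).1) theta (val c).2).

Definition flag_vector r theta v : vec R (bidx V) :=
  mkvec (fun c => dshare (val c).1 (weight r (val c).1) theta v (val c).2).

Lemma bcrd_flag_point r theta K i : i \in K ->
  bcrd (flag_point r theta) K i = share K (weight r K) theta i.
Proof. by move=> iK; rewrite (bcrd_mkvec (fun K => share K (weight r K) theta)) iK. Qed.

Lemma bcrd_flag_vector r theta v K i : i \in K ->
  bcrd (flag_vector r theta v) K i = dshare K (weight r K) theta v i.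
Proof.
by move=> iK; rewrite (bcrd_mkvec (fun K => dshare K (weight r K) theta v)) iK.
Qed.

Lemma flag_point_blowup r theta : admissible r -> positive theta ->
  blowup (flag_point r theta).
Proof.
move=> r_small theta0; split=> [K i iK|K|K H KH i iK].
- rewrite bcrd_flag_point// mulr_ge0 ?invr_ge0//.
    by rewrite mulr_ge0 ?weight_ge0// ltW.
  exact/ltW/(ssum_gt0 _ _ iK).
- case/set0Pn => i iK.
  rewrite (eq_bigr _ (fun i => @bcrd_flag_point r theta K i)) -mulr_suml divff//.
  by rewrite gt_eqF// (ssum_gt0 _ _ iK).
- have iH := fintype.subsetP KH _ iK.
  have [s ws] := weight_sub r KH.
  have -> : bratio (flag_point r theta) K H =
      s * ssum K (weight r K) theta / ssum H (weight r H) theta.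
    rewrite -(ssum_scale _ ws) mulr_suml; apply: eq_bigr => i' i'K.
    by rewrite bcrd_flag_point//; exact: (fintype.subsetP KH).
  rewrite !bcrd_flag_point// /share ws//.
  by field; rewrite !gt_eqF// ?(ssum_gt0 _ _ iK)// (ssum_gt0 _ _ iH).
Qed.

Lemma flag_point_derive_cvg r theta v : admissible r -> positive theta ->
  h^-1 *: (flag_point r (h *: v + theta) - flag_point r theta) @[h --> (0 : R)^']
    --> flag_vector r theta v.
Proof.
move=> r_small theta0; apply: cvg_crd => c; rewrite crd_mkvec.
under eq_fun do rewrite crd_scale crd_sub !crd_mkvec.
apply: share_cvg_line; rewrite gt_eqF// (ssum_gt0 _ _ (valP c))//.
Qed.

Lemma near_positive theta v : positive theta ->
  \forall h \near (0 : R), positive (h *: v + theta).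
Proof.
move=> theta0; 
apply: (@filter_forall _ _ (fun i h => 0 < crd (h *: v + theta) i) (nbhs 0)) => i.
have line_cvg : h * crd v i + crd theta i @[h --> (0 : R)] --> crd theta i.
  rewrite -[X in _ --> X]add0r -[X in _ --> X + _](mul0r (crd v i)).
  by apply: cvgD; [apply: cvgMr_tmp; exact: cvg_id|exact: cvg_cst].
by apply: filterS (cvgr_gt _ line_cvg _ (theta0 i)) => h; rewrite crd_line.
Qed.

(** The segment [theta + h v] stays positive for small [h], so it is mapped to a
    curve of the blow-up with velocity [flag_vector]. *)
Lemma flag_vector_tangent r theta v : admissible r -> positive theta ->
  tangent_space blowup (flag_point r theta) (flag_vector r theta v).
Proof.
move=> r_small theta0; exists 1, (fun=> 1), (fun=> flag_vector r theta v); split.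
  move=> _; exists (fun h => flag_point r (h *: v + theta)); split.
    apply: cvg_within; have := near_positive v theta0.
    by apply: filterS => h; exact: flag_point_blowup.
  exact/cvg_dnbhs_at_right/flag_point_derive_cvg.
by rewrite big_ord1 scale1r.
Qed.

Lemma bary_rcons_cvg r (j : 'I_m.+1) : bary (rcons r t) j @[t --> (0 : R)^'+] --> bary r j.
Proof.
have t_cvg : t @[t --> (0 : R)^'+] --> (0 : R) by apply: cvg_within.
rewrite /bary; case: (val j) => [|j'] /=.
  under eq_fun do rewrite -cats1 big_cat big_seq1.
  apply: cvgB; first exact: cvg_cst.
  by rewrite -[X in _ --> X]addr0; apply: cvgD => //; exact: cvg_cst.
under eq_fun do rewrite nth_rcons.
have [_|rj'] := ltnP j' (size r); first exact: cvg_cst.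
by rewrite nth_default//; case: eqP => _ //; exact: cvg_cst.
Qed.

(** The new coordinate [t] tending to 0 may make all the weights of [K] vanish;
    a common factor [s t] is then divided out, which does not change shares. *)
Lemma weight_rcons r K : exists (s : R -> R) (u : R -> V -> R),
  [/\ forall t, 0 < t -> s t != 0,
      forall t i, i \in K -> weight (rcons r t) K i = s t * u t i &
      forall i, i \in K -> u t i @[t --> (0 : R)^'+] --> weight r K i].
Proof.
have [K_low|K_high] := boolP (low r K).
  exists (fun=> 1), (fun t => weight (rcons r t) K); split=> [t _|t i _|i iK].
  - exact: oner_neq0.
  - by rewrite mul1r.
  - rewrite /weight K_low; under eq_fun => t.
      have -> : low (rcons r t) K.
        case/exists_inP: K_low => i' i'K i'r; apply/exists_inP.
        by exists i' => //; rewrite size_rcons ltnW.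
      over.
    exact: bary_rcons_cvg.
have low_rcons t : low (rcons r t) K = low (rcons r 0) K.
  by rewrite /low !size_rcons.
have K_gt i : i \in K -> (size r < blk F i)%N.
  by move=> iK; rewrite ltnNge; apply: contraNN K_high => ir; apply/exists_inP; exists i.
have [K_low|K_high'] := boolP (low (rcons r 0) K); last first.
  exists (fun=> 1), (fun=> weight r K); split=> [t _|t i iK|i iK].
  - exact: oner_neq0.
  - by rewrite mul1r /weight low_rcons (negbTE K_high) (negbTE K_high').
  - exact: cvg_cst.
(* Here the first block met by [K] is the one of mass [t]. *)
exists id, (fun=> weight r K); split=> [t t0|t i iK|i iK]; last exact: cvg_cst.
  by rewrite gt_eqF.
have [i0 i0K i0r] := exists_inP K_low.
have {}i0r : blk F i0 = (size r).+1 :> nat.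
  by apply/eqP; rewrite eqn_leq K_gt// -(size_rcons r 0) i0r.
rewrite /weight low_rcons K_low (negbTE K_high) /bary.
have -> : leading K i = (blk F i == (size r).+1 :> nat).
  apply/forall_inP/eqP => [/(_ _ i0K)|ir i' i'K]; last by rewrite ir K_gt.
  by rewrite i0r => ir; apply/eqP; rewrite eqn_leq ir K_gt.
have := K_gt _ iK; case: (val (blk F i)) => // j' /=; rewrite ltnS eqSS nth_rcons => rj'.
by rewrite ltnNge rj' /=; case: eqP => _; rewrite ?mulr1 ?mulr0.
Qed.

Lemma flag_point_rcons_cvg r theta : admissible r -> positive theta ->
  flag_point (rcons r t) theta @[t --> (0 : R)^'+] --> flag_point r theta.
Proof.
move=> r_small theta0; apply: cvg_crd => c; rewrite crd_mkvec.
under eq_fun do rewrite crd_mkvec.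
have cK := valP c; set K := (val c).1 in cK *.
have [s [u [s0 wu u_cvg]]] := weight_rcons r K.
apply: (@cvg_near_eq _ _ _ _ _ (fun t => share K (u t) theta (val c).2)).
  near=> t; have t0 : 0 < t by near: t; exact: nbhs_right_gt.
  by apply: (share_scale _ (s0 t t0)) => // i; exact: wu.
by apply: share_cvg => //; rewrite gt_eqF// (ssum_gt0 _ _ cK).
Unshelve. all: by end_near.
Qed.

Lemma flag_vector_rcons_cvg r theta v : admissible r -> positive theta ->
  flag_vector (rcons r t) theta v @[t --> (0 : R)^'+] --> flag_vector r theta v.
Proof.
move=> r_small theta0; apply: cvg_crd => c; rewrite crd_mkvec.
under eq_fun do rewrite crd_mkvec.
have cK := valP c; set K := (val c).1 in cK *.
have [s [u [s0 wu u_cvg]]] := weight_rcons r K.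
apply: (@cvg_near_eq _ _ _ _ _ (fun t => dshare K (u t) theta v (val c).2)).
  near=> t; have t0 : 0 < t by near: t; exact: nbhs_right_gt.
  by apply: (dshare_scale _ _ (s0 t t0)) => // i; exact: wu.
by apply: dshare_cvg => //; rewrite gt_eqF// (ssum_gt0 _ _ cK).
Unshelve. all: by end_near.
Qed.
End BlowUpPoint.

(** * The iterated limit and the face of the blow-up *)

Section IteratedLimit.
Local Open Scope classical_set_scope.
Local Open Scope ring_scope.
Context {R : realType} {V : finType} {m : nat} (F : flag V m).
Implicit Types (r : seq R) (theta v : vec R V).

Lemma Phi_crd rho theta i : crd (Phi F rho theta) i = rho (blk F i) * crd theta i.
Proof. by rewrite crd_mkvec (sum_mem_block _ (fun j => rho j * crd theta i)). Qed.

Lemma derive_Phi rho theta v : 'D_v (Phi F rho) theta = Phi F rho v.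
Proof.
apply: derive_line => h; apply: crdP => i.
by rewrite crd_line !Phi_crd crd_line; ring.
Qed.

Lemma blowdown_crd (x : vec R (bidx V)) i : crd (blowdown x) i = bcrd x [set: V]%SET i.
Proof. exact: crd_mkvec. Qed.

Lemma derive_blowdown (x y : vec R (bidx V)) : 'D_y (@blowdown R V) x = blowdown y.
Proof.
apply: derive_line => h; apply: crdP => i.
by rewrite crd_line !blowdown_crd bcrd_line.
Qed.

Lemma sum_bary r : size r = m -> \sum_(j < m.+1) bary r j = 1.
Proof.
move=> rm; rewrite big_ord_recl /bary /=.
rewrite [X in _ + X](_ : _ = \sum_(x <- r) x); first by rewrite subrK.
by rewrite (big_nth 0) rm big_mkord.
Qed.

Lemma weight_full r (K : {set V}) i : size r = m -> i \in K ->
  weight F r K i = bary r (blk F i).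
Proof.
move=> rm iK; rewrite /weight (_ : low F r K)//.
by apply/exists_inP; exists i => //; rewrite rm -ltnS.
Qed.

Lemma ssum_full r theta : size r = m ->
  ssum [set: V]%SET (weight F r [set: V]%SET) theta =
  \sum_j bary r j * \sum_(i in F j) crd theta i.
Proof.
move=> rm; rewrite /ssum (eq_bigl xpredT) => [|i]; last by rewrite inE.
rewrite (sum_blocks F); apply: eq_bigr => j _; rewrite mulr_sumr.
apply: eq_bigr => i; rewrite weight_full ?inE// mem_block => /eqP <- //.
Qed.

Lemma ssum_full_Theta r theta : size r = m -> Theta_int F theta ->
  ssum [set: V]%SET (weight F r [set: V]%SET) theta = 1.
Proof.
move=> rm [_ theta1]; rewrite ssum_full// -(sum_bary rm).
by apply: eq_bigr => j _; rewrite theta1 mulr1.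
Qed.

Lemma ssum_full_tangent r v : size r = m -> Theta_tangent F v ->
  ssum [set: V]%SET (weight F r [set: V]%SET) v = 0.
Proof. by move=> rm v0; rewrite ssum_full// big1// => j _; rewrite v0 mulr0. Qed.

Lemma flag_point_int r theta : size r = m -> admissible r -> Theta_int F theta ->
  blowup_int (flag_point F r theta).
Proof.
move=> rm r_small [theta0 _]; split; first exact: flag_point_blowup.
move=> K i iK; rewrite bcrd_flag_point// /share weight_full//.
rewrite divr_gt0// ?(ssum_gt0 _ _ _ iK)// mulr_gt0// bary_gt0//.
by rewrite rm -ltnS.
Qed.

Lemma blowdown_flag_point r theta : size r = m -> Theta_int F theta ->
  blowdown (flag_point F r theta) = Phi F (bary r) theta.
Proof.
move=> rm theta_int; apply: crdP => i.
rewrite blowdown_crd Phi_crd bcrd_flag_point ?inE// /share.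
by rewrite ssum_full_Theta// divr1 weight_full ?inE.
Qed.

Lemma blowdown_flag_vector r theta v : size r = m -> Theta_int F theta ->
  Theta_tangent F v -> blowdown (flag_vector F r theta v) = Phi F (bary r) v.
Proof.
move=> rm theta_int v0; apply: crdP => i.
rewrite blowdown_crd Phi_crd bcrd_flag_vector ?inE// /dshare.
rewrite ssum_full_Theta// ssum_full_tangent// mulr0 subr0 expr1n divr1 mulr1.
by rewrite weight_full ?inE.
Qed.

Context {k : nat} (psit : kform (R := R) k (vec R (bidx V)))
  (psi : kform (R := R) k (vec R V)).
Hypothesis smooth_psit : smooth_kform_on blowup psit.
Hypothesis psi_psit : corresponds psit psi.

Lemma pullback_Phi r theta (v : 'I_k -> vec R V) :
  size r = m -> admissible r -> Theta_int F theta -> (forall a, Theta_tangent F (v a)) ->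
  pullback (Phi F (bary r)) psi theta v =
  psit (flag_point F r theta) (fun a => flag_vector F r theta (v a)).
Proof.
move=> rm r_small theta_int v_tan.
rewrite -psi_psit; first last.
- by move=> a; apply: flag_vector_tangent => //; case: theta_int.
- exact: flag_point_int.
rewrite /pullback blowdown_flag_point//; congr psi; apply/funext => a.
by rewrite derive_Phi derive_blowdown blowdown_flag_vector.
Qed.

(** Induction on the number [d] of limits still to be taken; the base case, where
    no coordinate has vanished, is the correspondence between [psi] and [psit]
    on the interiors. *)
Lemma iterlim_flag d r theta (v : 'I_k -> vec R V) :
  (size r + d)%N = m -> admissible r -> Theta_int F theta ->
  (forall a, Theta_tangent F (v a)) ->
  let G r := pullback (Phi F (bary r)) psi theta v in
  iterlim_exists d G r /\
  iterlim d G r =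
    psit (flag_point F r theta) (fun a => flag_vector F r theta (v a)).
Proof.
move=> + + theta_int v_tan G; have [theta0 _] := theta_int.
elim: d r => [|d IH] r; first by rewrite addn0 => rm r_small; split=> //; exact: pullback_Phi.
move=> rm r_small; have [r0 r1] := r_small.
have admissible_rcons t : 0 < t -> \sum_(x <- rcons r t) x < 1 -> admissible (rcons r t).
  move=> t0 rt1; split=> // x; rewrite mem_rcons inE => /orP[/eqP -> //|]; exact: r0.
have admissible_near : \forall t \near (0 : R)^'+, admissible (rcons r t).
  near=> t; apply: admissible_rcons.
    by near: t; exact: nbhs_right_gt.
  rewrite -cats1 big_cat big_seq1 -ltrBrDl.
  by near: t; apply: nbhs_right_lt; rewrite subr_gt0.
have G_cvg : iterlim d G (rcons r t) @[t --> (0 : R)^'+] -->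
    psit (flag_point F r theta) (fun a => flag_vector F r theta (v a)).
  apply: (@cvg_near_eq _ _ _ _ _ (fun t => psit (flag_point F (rcons r t) theta)
     (fun a => flag_vector F (rcons r t) theta (v a)))).
    apply: filterS admissible_near => t rt_small; apply: (IH _ _ rt_small).2.
    by rewrite size_rcons addSnnS.
  apply: (@smooth_kform_on_cvg _ _ _ _ _ _ blowup psit
    (fun t => flag_point F (rcons r t) theta) _
    (fun t a => flag_vector F (rcons r t) theta (v a))) => //.
  - apply: filterS admissible_near => t rt_small; split; first exact: flag_point_blowup.
    by move=> a; exact: flag_vector_tangent.
  - exact: flag_point_blowup.
  - by move=> a; exact: flag_vector_tangent.
  - exact: flag_point_rcons_cvg.
  - by move=> a; exact: flag_vector_rcons_cvg.
split; last exact: cvg_lim.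
split; last exact: cvgP G_cvg.
move=> t t0 rt1; apply: (IH _ _ (admissible_rcons _ t0 rt1)).1.
by rewrite size_rcons addSnnS.
Unshelve. all: by end_near.
Qed.

Lemma admissible_nil : admissible ([::] : seq R).
Proof. by split=> //; rewrite big_nil ltr01. Qed.

Lemma leading_weight (K : {set V}) i : i \in K ->
  weight F ([::] : seq R) K i = (leading F K i)%:R.
Proof.
move=> iK; rewrite /weight; case: ifP => // /exists_inP[i0 i0K /=].
rewrite leqn0 => /eqP i00; rewrite /bary big_nil subr0.
have -> : leading F K i = (blk F i == 0 :> nat).
  apply/forall_inP/eqP => [/(_ _ i0K)|-> //].
  by rewrite i00 leqn0 => /eqP.
by case: (val (blk F i)) => //= j; rewrite nth_nil.
Qed.

(** On the face, an edge from [i0] to [i'] with [i0] in an earlier block gives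
    [lambda_i'^K = 0] for every [K] containing the edge.  Hence the coordinates
    on [K] are supported by the part [L] of [K] in its first block [V_j], and are
    there the coordinates on [L], which [theta] determines
    because [L] lies in [V_j]. *)
Lemma face_unique (x : vec R (bidx V)) theta : Theta_int F theta ->
  blowup_face F x -> face_chart F x = theta -> x = flag_point F [::] theta.
Proof.
move=> [theta0 _] [[x_ge0 x_sum x_sub] x_face] x_theta.
have x_block i : bcrd x (F (blk F i)) i = crd theta i.
  by rewrite -x_theta crd_mkvec (sum_mem_block _ (fun j => bcrd x (F j) i)).
apply: bcrdP => K i iK; rewrite bcrd_flag_point// /share leading_weight//.
have x_out i' : i' \in K -> ~~ leading F K i' -> bcrd x K i' = 0.
  move=> i'K /forall_inPn[i0 i0K]; rewrite -ltnNge => i0i'.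
  rewrite (@x_sub [set i0; i']%SET) ?inE ?eqxx ?orbT//; last first.
    by apply/fintype.subsetP => z; rewrite !inE => /orP[] /eqP ->.
  by rewrite (@x_face (blk F i0) (blk F i')) ?mem_block ?mulr0.
have [i_lead|i_out] := boolP (leading F K i); last by rewrite mul0r mul0r x_out.
pose L := [set i' in K | leading F K i']%SET.
have iL : i \in L by rewrite !inE iK.
have LK : L \subset K by apply/fintype.subsetP => z; rewrite inE => /andP[].
have L_sum (f : V -> R) : (forall i', i' \in K -> ~~ leading F K i' -> f i' = 0) ->
    \sum_(i' in K) f i' = \sum_(i' in L) f i'.
  move=> f0; rewrite (bigID (leading F K))/= [X in _ + X]big1 ?addr0.
    by apply: eq_bigl => i'; rewrite inE.
  by move=> i' /andP[]; exact: f0.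
have LF : L \subset F (blk F i).
  apply/fintype.subsetP => i'; rewrite inE => /andP[i'K i'_lead].
  rewrite mem_block; apply/eqP/val_inj/eqP; rewrite eqn_leq.
  by rewrite (forall_inP i_lead)// (forall_inP i'_lead).
have xK1 : bratio x L K = 1.
  rewrite /bratio -L_sum// x_sum//; apply/set0Pn; by exists i.
rewrite (x_sub _ _ LK)// xK1 mul1r.
rewrite /ssum L_sum; last first.
  by move=> i' i'K i'_out; rewrite leading_weight// (negbTE i'_out) mul0r.
have -> : \sum_(i' in L) weight F [::] K i' * crd theta i' = bratio x L (F (blk F i)).
  apply: eq_bigr => i' i'L; have := i'L; rewrite inE => /andP[i'K i'_lead].
  rewrite leading_weight// i'_lead mul1r -x_block.
  by have := fintype.subsetP LF _ i'L; rewrite mem_block => /eqP <-.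
have := x_sub _ _ LF _ iL; rewrite x_block => theta_i.
rewrite mul1r theta_i mulrAC divff ?mul1r//.
by apply: contraTneq (theta0 i) => rho0; rewrite theta_i rho0 mul0r ltxx.
Qed.

Lemma flag_point_face theta : Theta_int F theta ->
  blowup_face F (flag_point F [::] theta) /\ face_chart F (flag_point F [::] theta) = theta.
Proof.
move=> [theta0 theta1]; split.
  split; first exact: flag_point_blowup admissible_nil theta0.
  move=> j j' i i' jj'; rewrite !mem_block => /eqP ji /eqP ji'.
  rewrite bcrd_flag_point ?inE ?eqxx ?orbT// /share leading_weight ?inE ?eqxx ?orbT//.
  rewrite (_ : leading F _ _ = false) ?mul0r ?mul0r//.
  apply/negbTE/forall_inPn; exists i; rewrite ?inE ?eqxx//.
  by rewrite -ji -ji' -ltnNge.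
apply: crdP => i; rewrite crd_mkvec.
have lead_blk i' : i' \in F (blk F i) -> weight F [::] (F (blk F i)) i' = 1 :> R.
  move=> i'F; rewrite leading_weight// (_ : leading F _ _)//.
  apply/forall_inP => i''; move: i'F; rewrite !mem_block => /eqP <- /eqP <-.
  exact: leqnn.
rewrite (sum_mem_block _ (fun j => bcrd _ (F j) i)).
have iF : i \in F (blk F i) by rewrite mem_block.
rewrite bcrd_flag_point// /share lead_blk// mul1r /ssum.
rewrite (eq_bigr (crd theta)); first by rewrite theta1 divr1.
by move=> i' i'F; rewrite lead_blk// mul1r.
Qed.

Lemma face_paramE theta : Theta_int F theta ->
  face_param F theta = flag_point F [::] theta.
Proof.
move=> theta_int; rewrite /face_param.
have [] := @getPex _ [set x | blowup_face F x /\ face_chart F x = theta].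
  by exists (flag_point F [::] theta); exact: flag_point_face.
exact: face_unique.
Qed.

(** [face_param] is only known on the interior of [Theta_F], which has empty
    interior in the ambient space; a direction tangent to [Theta_F] does not
    leave it. *)
Lemma derive_face_param theta v : Theta_int F theta -> Theta_tangent F v ->
  'D_v (face_param F) theta = flag_vector F [::] theta v.
Proof.
move=> theta_int v_tan; have [theta0 theta1] := theta_int.
apply: derive_cvg.
apply: (@cvg_near_eq _ _ _ _ _ (fun h : R =>
    h^-1 *: (flag_point F [::] (h *: v + theta) - flag_point F [::] theta)));
  last exact: flag_point_derive_cvg admissible_nil theta0.
apply: cvg_within; have := near_positive v theta0; apply: filterS => h line0.
rewrite !face_paramE//; split=> // j.
under eq_bigr do rewrite crd_line.
by rewrite big_split/= -mulr_sumr v_tan mulr0 add0r theta1.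
Qed.

Lemma limit_formE theta (v : 'I_k -> vec R V) :
  Theta_int F theta -> (forall a, Theta_tangent F (v a)) ->
  limit_form F psi theta v = pullback (face_param F) psit theta v.
Proof.
move=> theta_int v_tan.
rewrite /limit_form; have [_ ->] := iterlim_flag (r := [::]) (add0n m) admissible_nil theta_int v_tan.
rewrite /pullback face_paramE//; congr psit; apply/funext => a.
by rewrite derive_face_param.
Qed.

Lemma limit_form_exists_corresponds : limit_form_exists F psi.
Proof.
move=> theta theta_int v v_tan.
exact: (iterlim_flag (r := [::]) (add0n m) admissible_nil theta_int v_tan).1.
Qed.
End IteratedLimit.

(** * The chart of the product of simplices *)

Section Chart.
Local Open Scope classical_set_scope.
Local Open Scope ring_scope.
Context {R : realType} {V : finType} {m : nat} (F : flag V m).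
Variable o : forall W : {set V}, orientation W.

Lemma size_ori_seq W : size (ori_seq (o W)) = #|W|.
Proof. by rewrite (perm_size (ori_perm (o W))) cardE. Qed.

Lemma size_chart_vertices : (size (chart_vertices F o) + m.+1 = #|V|)%N.
Proof.
rewrite size_flatten /shape -map_comp sumnE big_map big_enum /=.
have sum1 : (\sum_(j < m.+1) 1)%N = m.+1 by rewrite sum1_card card_ord.
rewrite -[X in (_ + X)%N]sum1 (eq_bigl xpredT)// -big_split /= -sum1_card (sum_blocks F); apply: eq_bigr => j _.
rewrite size_behead size_ori_seq sum1_card addn1 prednK//.
by have [i iF] := block_neq0 F j; apply/card_gt0P; exists i.
Qed.

Lemma chart_base_vertex j : exists2 i0, i0 \in F j &
  forall i, i \in F j -> (i \in chart_vertices F o) = (i != i0).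
Proof.
have s_perm := ori_perm (o (F j)); have s_uniq := perm_uniq s_perm.
rewrite enum_uniq in s_uniq.
have s_mem i : (i \in ori_seq (o (F j))) = (i \in F j).
  by rewrite (perm_mem s_perm) mem_enum.
have in_chart i : i \in F j ->
    (i \in chart_vertices F o) = (i \in behead (ori_seq (o (F j)))).
  move=> iF; apply/flatten_mapP/idP => [[j' _ ij']|ij]; last first.
    by exists j; rewrite ?mem_enum.
  have : i \in F j' by rewrite -mem_enum -(perm_mem (ori_perm (o (F j')))) mem_behead.
  move: iF; rewrite !mem_block => /eqP jE /eqP j'E.
  by rewrite jE -j'E.
case s_def : (ori_seq (o (F j))) in_chart s_mem s_uniq => [|i0 s] in_chart s_mem.
  by have [i] := block_neq0 F j; rewrite -s_mem.
rewrite /= => /andP[i0s _]; exists i0 => [|i iF]; first by rewrite -s_mem mem_head.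
rewrite in_chart//=; move: iF; rewrite -s_mem inE.
by case: eqVneq => [-> _|_ //]; exact/negbTE.
Qed.

Context {k : nat}.
Implicit Types u v : 'rV[R]_k.

Definition chart_coord u i : R :=
  if insub (index i (chart_vertices F o)) is Some a then u 0 a else 0.

Lemma chart_coord_line h v u i :
  chart_coord (h *: v + u) i = h * chart_coord v i + chart_coord u i.
Proof.
by rewrite /chart_coord; case: insub => [a|]; rewrite ?mulr0 ?addr0// !mxE.
Qed.

Lemma chart_inv_crd u i : crd (chart_inv F o u) i =
  if i \in chart_vertices F o then chart_coord u i
  else 1 - \sum_(i' in F (blk F i)) chart_coord u i'.
Proof.
rewrite crd_mkvec; case: ifP => // _.
by rewrite (sum_mem_block _ (fun j => \sum_(i' in F j) chart_coord u i')).
Qed.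

Lemma derive_chart_inv u v :
  'D_v (chart_inv F o (k := k)) u = chart_inv F o v - chart_inv F o (0 : 'rV_k).
Proof.
apply: derive_line => h; apply: crdP => i.
have coord0 i' : chart_coord 0 i' = 0.
  by rewrite /chart_coord; case: insub => // a; rewrite mxE.
rewrite crd_line crd_sub !chart_inv_crd; case: ifP => _.
  by rewrite chart_coord_line coord0 subr0.
under eq_bigr do rewrite chart_coord_line.
rewrite big_split/= -mulr_sumr [X in _ - (1 - X)]big1 => [|i' _]; last exact: coord0.
by ring.
Qed.

Hypothesis size_chart : (k <= size (chart_vertices F o))%N.

(** In each block, the first vertex of the ordering receives what the others
    leave.  Its own [chart_coord] is 0 because its index in [chart_vertices] is
    the size of that list, which is at least [k]: hence the bound on [k]. *)
Lemma chart_inv_sum u j : \sum_(i in F j) crd (chart_inv F o u) i = 1.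
Proof.
have [i0 i0F in_chart] := chart_base_vertex j.
have coord0 : chart_coord u i0 = 0.
  rewrite /chart_coord insubN// -leqNgt memNindex// in_chart//.
  by rewrite eqxx.
have -> : F j = F (blk F i0).
  by congr (F _); apply/eqP; rewrite -mem_block.
rewrite (bigD1 i0) ?mem_block//= chart_inv_crd in_chart// eqxx/=.
rewrite [X in 1 - X](bigD1 i0) ?mem_block//= coord0 add0r.
rewrite [X in _ + X](eq_bigr (chart_coord u)) ?subrK// => i /andP[iF ii0].
rewrite chart_inv_crd in_chart ?ii0//.
by move: iF i0F; rewrite !mem_block => /eqP -> /eqP ->.
Qed.

Lemma derive_chart_inv_tangent u v : Theta_tangent F ('D_v (chart_inv F o (k := k)) u).
Proof.
move=> j; rewrite derive_chart_inv; under eq_bigr do rewrite crd_sub.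
by rewrite sumrB !chart_inv_sum subrr.
Qed.

(** The integral only evaluates a form at interior points of [Theta_F], on the
    derivatives of the chart, which are tangent to [Theta_F]. *)
Lemma eq_integral_Theta (eta eta' : kform (R := R) k (vec R V)) :
  (forall theta (v : 'I_k -> vec R V), Theta_int F theta -> (forall a, Theta_tangent F (v a)) ->
     eta theta v = eta' theta v) ->
  integral_Theta F o eta = integral_Theta F o eta'.
Proof.
move=> eta_eta'; rewrite /integral_Theta.
have [mu ->] := @lebesgue_tuple_sigma_finite R k.
apply: eq_integral => u; rewrite inE /= => u_int.
congr ((_ * _)%:E); apply: eta_eta' => // a; exact: derive_chart_inv_tangent.
Qed.
End Chart.

Theorem proposition3p12 (R : realType) (V : finType) (n k : nat)
  (card_V : #|V| = n.+1) (le_kn : (k <= n)%N)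
  (o : forall W : {set V}, orientation W) (F : flag V (n - k))
  (psit : kform k (vec R (bidx V))) (psi : kform k (vec R V))
  (smooth_psit : smooth_kform_on blowup psit)
  (psi_psit : corresponds psit psi) :
  limit_form_exists F psi /\ Psi F o psi = integral_face F o psit.
Proof.
split; first exact: limit_form_exists_corresponds smooth_psit psi_psit.
apply: eq_integral_Theta => [|theta v theta_int v_tan].
  rewrite -(leq_add2r (n - k).+1) size_chart_vertices card_V addnS.
  by rewrite subnKC.
exact: limit_formE.
Qed.
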